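(* Let $u=u_1\cdots u_r$ be an allowed prime word of $\Sigma_A$ with $r\ge2$. If $w=w_1\cdots w_r\in\mathcal L_r$ satisfies $w_1=u_1$, $w_r=u_r$ and $\delta_w=\delta_u$, then $\rho(C_w)\le\rho(C_u)$. Moreover, if $1$ is the only positive real eigenvalue of $P$, then $\rho(C_w)=\rho(C_u)$ if and only if $w$ is a prime word.
   Context: Let $\Sigma=\{1,\dots,N\}$, $A$ an irreducible $N\times N$ $0$–$1$ matrix, $\Sigma_A=\{x\in\Sigma^{\mathbb N}:A_{x_nx_{n+1}}=1\ \forall n\}$ with left shift $\sigma$; $\mathcal L_r$ is the set of allowed words of length $r$ (occurring in some element of $\Sigma_A$); $C_u$ is the set of $x\in\Sigma_A$ beginning with $u$. $P$ is a row-stochastic matrix with $P_{ij}>0$ iff $A_{ij}=1$, $\mathbf p$ its stationary vector, $\mu=\mu_P$ the Markov measure $\mu(C_v)=p_{v_1}P_{v_1v_2}\cdots P_{v_{n-1}v_n}$. For a hole $H$, $\mathcal W_m=\{x:\sigma^ix\notin H,0\le i\le m\}$ and $\rho(H)=-\lim_m\frac1m\ln\mu(\mathcal W_m)$. For a word $v=v_1\cdots v_r$, $\delta_v=P_{v_1v_2}\cdots P_{v_{r-1}v_r}$. A word $v=v_1\cdots v_r$ is prime if for $0\le s\le r-1$ the equality $v_{s+1}\cdots v_r=v_1\cdots v_{r-s}$ holds only for $s=0$. *)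

(* Defs.v *)
From HB Require Import structures.
From mathcomp Require Import all_boot all_order all_algebra.
From mathcomp Require Import all_classical all_reals all_analysis.
Set Implicit Arguments. Unset Strict Implicit. Unset Printing Implicit Defensive.
Import Order.TTheory GRing.Theory Num.Theory numFieldNormedType.Exports.
Local Open Scope ring_scope.

(* Alphabet Sigma = 'I_N; transition 0-1 matrix A given as a boolean relation. *)

Definition irreducible_mx (N : nat) (A : 'I_N -> 'I_N -> bool) : Prop :=
  forall i j : 'I_N, exists k, A i k && connect (fun a b => A a b) k j.

Definition in_SigmaA (N : nat) (A : 'I_N -> 'I_N -> bool) (x : nat -> 'I_N) : Prop :=
  forall n, A (x n) (x n.+1).

Definition allowed_word (N : nat) (A : 'I_N -> 'I_N -> bool) (v : seq 'I_N) : Prop :=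
  exists x : nat -> 'I_N, in_SigmaA A x /\
    exists k, mkseq (fun i => x (k + i)%N) (size v) = v.

Definition compatible_stochastic (R : realType) (N : nat)
    (A : 'I_N -> 'I_N -> bool) (P : 'M[R]_N) : Prop :=
  (forall i j, 0 <= P i j) /\ (forall i, \sum_j P i j = 1) /\
  (forall i j, (0 < P i j) = A i j).

Definition stationary_vector (R : realType) (N : nat) (P : 'M[R]_N) (p : 'rV[R]_N) : Prop :=
  (forall i, 0 <= p 0 i) /\ \sum_i p 0 i = 1 /\ p *m P = p.

Definition prime_word (T : eqType) (v : seq T) : Prop :=
  forall s, (0 < s < size v)%N -> drop s v <> take (size v - s) v.

Definition delta (R : realType) (N : nat) (P : 'M[R]_N) (v : seq 'I_N) : R :=
  \prod_(ab <- zip v (behead v)) P ab.1 ab.2.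

Definition mu_cyl (R : realType) (N : nat) (P : 'M[R]_N) (p : 'rV[R]_N) (v : seq 'I_N) : R :=
  match v with
  | [::] => 1
  | a :: _ => p 0 a * delta P v
  end.

(* mu(W_m) for the hole H = C_w : W_m = {x | sigma^i x notin C_w, 0 <= i <= m}
   is the finite union of the cylinders C_t, t of length m + |w|, such that w
   does not occur in t at any position i <= m. *)
Definition mu_W (R : realType) (N : nat) (P : 'M[R]_N) (p : 'rV[R]_N)
    (w : seq 'I_N) (m : nat) : R :=
  \sum_(t : (m + size w).-tuple 'I_N |
          [forall i : 'I_m.+1, take (size w) (drop i t) != w]) mu_cyl P p t.

Definition rho (R : realType) (N : nat) (P : 'M[R]_N) (p : 'rV[R]_N) (w : seq 'I_N) : R :=
  - limn (fun m : nat => ln (mu_W P p w m) / m%:R).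

(* Main.v *)
Require Import Defs.
From HB Require Import structures.
From mathcomp Require Import all_boot all_order all_algebra.
From mathcomp Require Import all_classical all_reals all_analysis.
From mathcomp Require Import ring lra zify.
Set Implicit Arguments. Unset Strict Implicit. Unset Printing Implicit Defensive.
Import Order.TTheory GRing.Theory Num.Theory numFieldNormedType.Exports.
Local Open Scope ring_scope.

(** Let [a] and [b] be the first and last letters of [u] and [w], and let [U]
and [V] be the generating series of the probabilities that the chain started
at [b] avoids [u], respectively [w], for [n] steps. Decomposing at the first
occurrence gives [(1 - X) U (H + 1) = 1] and [(1 - X) V (H + 1 + psi) = 1 + psi]:
the series [H] depends only on [a], [b], the length and [delta], and [psi >= 0]
records the proper self-overlaps of [w], which a prime word does not have. Hence
[V = U + U psi F], where [F >= 0] is the law of the first occurrence of [w], so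
that [U <= V] coefficientwise. Started from the stationary vector, the avoidance
probability of [u] drops at each step by [delta p_a] times a coefficient of [U],
and it decays geometrically, so it is comparable with [U]; this gives the
inequality of rates, which exist by Fekete's lemma. If [psi <> 0] and both rates
were equal to [L], then [U_n >= c e^(n L)] in [V >= U psi F] would force [V] to
grow faster than [e^(n L)]. *)

(** * Formal power series *)

(** An alias, so that the product can be the Cauchy product and [ring] can settle identities between
    generating series. *)
Definition fps (R : comNzRingType) : Type := nat -> R.

Section FormalPowerSeries.
Variable R : comNzRingType.
Implicit Types f g h : fps R.

HB.instance Definition _ := GRing.Zmodule.copy (fps R) (nat -> R).

Definition fps_one : fps R := fun n => (n == 0%N)%:R.
Definition fps_mul f g : fps R := fun n => \sum_(i < n.+1) f i * g (n - i)%N.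

(** Coefficient [n] of a product sees only coefficients up to [n], so the ring laws are inherited
    from truncations in [{poly R}]. *)
Let trunc f n : {poly R} := \poly_(i < n.+1) f i.

Let coef_trunc f n i : (i <= n)%N -> (trunc f n)`_i = f i.
Proof. by rewrite coef_poly ltnS => ->. Qed.

Let fps_mulE f g m n : (n <= m)%N ->
  fps_mul f g n = (trunc f m * trunc g m)`_n.
Proof.
move=> nm; rewrite coefM; apply: eq_bigr => i _.
have im := ltn_ord i; rewrite !coef_trunc //; lia.
Qed.

Let coef_mul_eq (p q p' q' : {poly R}) n :
  (forall i, (i <= n)%N -> p`_i = p'`_i) ->
  (forall i, (i <= n)%N -> q`_i = q'`_i) -> (p * q)`_n = (p' * q')`_n.
Proof.
move=> ep eq; rewrite !coefM; apply: eq_bigr => i _.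
have im := ltn_ord i; rewrite ep ?eq //; lia.
Qed.

Fact fps_mulA : associative fps_mul.
Proof.
move=> f g h; apply/funext => n; rewrite !(fps_mulE _ _ (leqnn n)).
transitivity ((trunc f n * (trunc g n * trunc h n))`_n).
  apply: coef_mul_eq => i ile //; rewrite coef_trunc //; exact: fps_mulE.
rewrite mulrA; apply: coef_mul_eq => i ile //; rewrite coef_trunc //.
by rewrite -fps_mulE.
Qed.

Fact fps_mulC : commutative fps_mul.
Proof. by move=> f g; apply/funext => n; rewrite !(fps_mulE _ _ (leqnn n)) mulrC. Qed.

Fact fps_mul1 : left_id fps_one fps_mul.
Proof.
move=> f; apply/funext => n; rewrite /fps_mul big_ord_recl /= subn0 mul1r.
by rewrite big1 ?addr0 // => i _; rewrite /fps_one /= mul0r.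
Qed.

Fact fps_mulDl : left_distributive fps_mul +%R.
Proof.
move=> f g h; apply/funext => n.
rewrite -[RHS]/(fps_mul f h n + fps_mul g h n) /fps_mul -big_split /=.
by apply: eq_bigr => i _; rewrite mulrDl.
Qed.

Fact fps_one_neq0 : fps_one != 0.
Proof. by apply/eqP => /(congr1 (fun f => f 0%N)) /eqP; rewrite oner_eq0. Qed.

HB.instance Definition _ := GRing.Zmodule_isComNzRing.Build (fps R)
  fps_mulA fps_mulC fps_mul1 fps_mulDl fps_one_neq0.

Definition fpsX : fps R := fun n => (n == 1%N)%:R.

Lemma fpsDE f g n : (f + g) n = f n + g n. Proof. by []. Qed.
Lemma fpsBE f g n : (f - g) n = f n - g n. Proof. by []. Qed.
Lemma fps1E n : (1 : fps R) n = (n == 0%N)%:R. Proof. by []. Qed.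
Lemma fpsME f g n : (f * g) n = \sum_(i < n.+1) f i * g (n - i)%N.
Proof. by []. Qed.

Lemma fpsXM0 f : (fpsX * f) 0%N = 0.
Proof. by rewrite fpsME big_ord1 mul0r. Qed.

Lemma fpsXMS f n : (fpsX * f) n.+1 = f n.
Proof.
rewrite fpsME big_ord_recl mul0r add0r big_ord_recl /= mul1r subn1 /=.
by rewrite big1 ?addr0 // => i _; rewrite mul0r.
Qed.

Lemma fps_sub1X0 f : ((1 - fpsX) * f) 0%N = f 0%N.
Proof. by rewrite mulrBl mul1r fpsBE fpsXM0 subr0. Qed.

Lemma fps_sub1XS f n : ((1 - fpsX) * f) n.+1 = f n.+1 - f n.
Proof. by rewrite mulrBl mul1r fpsBE fpsXMS. Qed.

End FormalPowerSeries.

(** * Expectations over finite trajectories *)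

Section PathExpectation.
Variables (R : realType) (N : nat) (P : 'M[R]_N).
Implicit Types (n k : nat) (i j : 'I_N) (t v : seq 'I_N) (h : seq 'I_N -> R).

(* The expectation of [h t], with [t] the first [n + 1] letters of the Markov
   chain started at [i]. *)
Fixpoint pexp n i h : R :=
  if n is m.+1 then \sum_j P i j * pexp m j (fun t => h (i :: t))
  else h [:: i].

Lemma mkseqS_cons (T : Type) (f : nat -> T) n :
  mkseq f n.+1 = f 0%N :: mkseq (fun m => f m.+1) n.
Proof. by rewrite /mkseq -[iota 0 n.+1]/(0%N :: iota (1 + 0) n) iotaDl /= -map_comp. Qed.

Lemma eq_pexp n i h h' : (forall t, size t = n -> h (i :: t) = h' (i :: t)) ->
  pexp n i h = pexp n i h'.
Proof.
elim: n i h h' => [|n IHn] i h h' hh' /=; first exact: hh'.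
by apply: eq_bigr => j _; congr (_ * _); apply: IHn => t st; apply: hh' => /=; rewrite st.
Qed.

Lemma pexpD n i h h' : pexp n i (fun t => h t + h' t) = pexp n i h + pexp n i h'.
Proof.
elim: n i h h' => [|n IHn] i h h' //=.
by rewrite -big_split; apply: eq_bigr => j _; rewrite /= IHn mulrDr.
Qed.

Lemma pexpZ n i c h : pexp n i (fun t => c * h t) = c * pexp n i h.
Proof.
elim: n i h => [|n IHn] i h //=.
by rewrite mulr_sumr; apply: eq_bigr => j _; rewrite IHn mulrCA.
Qed.

Lemma pexpZr n i c h : pexp n i (fun t => h t * c) = pexp n i h * c.
Proof. by rewrite mulrC -pexpZ; apply: eq_pexp => t _; rewrite mulrC. Qed.

Lemma pexp0 n i : pexp n i (fun=> 0) = 0.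
Proof.
rewrite -[RHS](mul0r (pexp n i (fun=> 0))) -pexpZ.
by apply: eq_pexp => t _; rewrite mul0r.
Qed.

Lemma pexpB n i h h' : pexp n i (fun t => h t - h' t) = pexp n i h - pexp n i h'.
Proof.
rewrite -[in RHS]mulN1r -pexpZ -pexpD.
by apply: eq_pexp => t _; rewrite mulN1r.
Qed.

Lemma pexp_sum n i m (F : 'I_m -> seq 'I_N -> R) :
  pexp n i (fun t => \sum_k F k t) = \sum_k pexp n i (F k).
Proof.
elim: m F => [|m IHm] F.
  by rewrite big_ord0 -[RHS](pexp0 n i); apply: eq_pexp => t _; rewrite big_ord0.
rewrite big_ord_recr -IHm /= -pexpD.
by apply: eq_pexp => t _; rewrite big_ord_recr.
Qed.

(** The Markov property: the chain restarts from its letter at time [n]. Both blocks contain that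
    letter, hence the [behead]. *)
Lemma pexp_cat n k i h : pexp (n + k) i h =
  pexp n i (fun t => pexp k (last i t) (fun t' => h (t ++ behead t'))).
Proof.
elim: n i h => [|n IHn] i h /=.
  by case: k.
apply: eq_bigr => j _; congr (_ * _); rewrite IHn.
by apply: eq_pexp => t _ /=.
Qed.

Lemma pexp_eqword i v : (0 < size v)%N ->
  pexp (size v).-1 i (fun t => (t == v)%:R) = (i == head i v)%:R * delta P v.
Proof.
case: v => [//|a v] _ /=; elim: v i a => [|c v IHv] i a /=.
  by rewrite /delta /= big_nil mulr1 eqseq_cons andbT.
rewrite (bigD1 c) //= big1 ?addr0; last first.
  move=> j /negPf jc.
  rewrite (_ : (fun t => _) = fun t => (i == a)%:R * (t == c :: v)%:R); last first.
    by apply/funext => t; rewrite eqseq_cons -natrM mulnb.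
  by rewrite pexpZ IHv jc mul0r !mulr0.
rewrite (_ : (fun t => _) = fun t => (i == a)%:R * (t == c :: v)%:R); last first.
  by apply/funext => t; rewrite eqseq_cons -natrM mulnb.
rewrite pexpZ IHv eqxx mul1r /delta /= big_cons /=.
by case: eqP => [->|]; rewrite ?mul0r ?mulr0 ?mul1r.
Qed.

Hypothesis P_ge0 : forall i j, 0 <= P i j.

Lemma le_pexp n i h h' :
  (forall t, size t = n -> h (i :: t) <= h' (i :: t)) ->
  pexp n i h <= pexp n i h'.
Proof.
elim: n i h h' => [|n IHn] i h h' hh' /=; first exact: hh'.
apply: ler_sum => j _; apply: ler_wpM2l => //.
by apply: IHn => t st; apply: hh' => /=; rewrite st.
Qed.

Lemma pexp_ge0 n i h : (forall t, 0 <= h t) -> 0 <= pexp n i h.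
Proof. by move=> h0; rewrite -(pexp0 n i); apply: le_pexp. Qed.

(** Only the trajectory [x] is kept in the expectation. *)
Lemma pexp_path_ge (A : 'I_N -> 'I_N -> bool) (x : nat -> 'I_N) e n h :
  0 <= e -> (forall i j, A i j -> e <= P i j) -> in_SigmaA A x ->
  (forall t, 0 <= h t) -> e ^+ n * h (mkseq x n.+1) <= pexp n (x 0%N) h.
Proof.
move=> e0 eP; elim: n x h => [|n IHn] x h Ax h0 /=; first by rewrite mul1r.
rewrite (bigD1 (x 1%N)) //= -[leLHS]addr0; apply: lerD; last first.
  by apply: sumr_ge0 => j _; rewrite mulr_ge0 // pexp_ge0.
rewrite exprS -mulrA; apply: ler_pM => //.
- by rewrite mulr_ge0 // exprn_ge0.
- exact/eP/Ax.
rewrite mkseqS_cons; apply: (IHn (fun m => x m.+1) (fun t => h (x 0%N :: t))) => //.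
Qed.

Hypothesis P_sum1 : forall i, \sum_j P i j = 1.

Lemma pexp_cst n i c : pexp n i (fun=> c) = c.
Proof.
elim: n i => [|n IHn] i //=.
by under eq_bigr do rewrite IHn; rewrite -mulr_suml P_sum1 mul1r.
Qed.

Lemma pexp_stationary (p : 'rV[R]_N) n (f : 'I_N -> R) : p *m P = p ->
  \sum_i p 0 i * pexp n i (fun t => f (last i t)) = \sum_i p 0 i * f i.
Proof.
move=> pP; elim: n => [|n IHn] //=.
rewrite -IHn -[in RHS]pP; under eq_bigr do rewrite mulr_sumr.
rewrite exchange_big; apply: eq_bigr => j _ /=; rewrite mxE mulr_suml.
by apply: eq_bigr => i _; rewrite mulrA; congr (_ * _); apply: eq_pexp.
Qed.

End PathExpectation.

(** * The renewal equation for occurrences of a word *)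

Lemma suffix_cat_long (T : eqType) (w s t : seq T) : (size w <= size t)%N ->
  suffix w (s ++ t) = suffix w t.
Proof.
move=> wt; rewrite !suffixE size_cat drop_cat ltnNge.
rewrite (_ : (size s <= size s + size t - size w)%N) /=; last by lia.
by congr (drop _ _ == _); lia.
Qed.

Section Renewal.
Variables (R : realType) (N : nat) (P : 'M[R]_N) (w : seq 'I_N) (a b : 'I_N).
Hypothesis P_sum1 : forall i, \sum_j P i j = 1.
Hypothesis w_gt0 : (0 < size w)%N.
Hypothesis w_head : forall i, head i w = a.
Hypothesis w_last : forall i, last i w = b.
Implicit Types (i j : 'I_N) (t : seq 'I_N).

Definition surv i : fps R := fun n => pexp P n i (fun t => (~~ infix w t)%:R).

Definition hits i : fps R := fun n => pexp P n i (fun t => (suffix w t)%:R).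

(** Occurrence probabilities when [w] has just been read and the chain sits at its last letter [b].
    The constant coefficient counts that first copy itself. *)
Definition rehits : fps R :=
  fun n => pexp P n b (fun t => (suffix w (w ++ behead t))%:R).

(** The law of the time at which the first occurrence ends, written as the successive drops of the
    survival probability. *)
Definition first_hit i : fps R := 1 - (1 - fpsX R) * surv i.

(** Containing [w] is preserved by extension, so this difference is the indicator that the first
    occurrence of [w] ends at the last letter of [t]. *)
Let fresh t : R := (infix w t)%:R - (infix w (take (size t).-1 t))%:R.

Let infix_nil : infix w [::] = false.
Proof. by rewrite infixs0; case: (w) w_gt0. Qed.

Let fresh_suffix t : fresh t = fresh t * (suffix w t)%:R.
Proof.
rewrite /fresh; case/lastP: t => [|t x]; first by rewrite infix_nil subrr mul0r.
rewrite size_rcons -cats1 take_size_cat // cats1 infix_rconsl.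
by case: suffix => /=; rewrite ?mulr1 ?subrr ?mul0r.
Qed.

Lemma pexp_take n k i (h : seq 'I_N -> R) :
  pexp P (n + k) i (fun t => h (take n.+1 t)) = pexp P n i h.
Proof.
rewrite pexp_cat; apply: eq_pexp => t st.
rewrite -[RHS](pexp_cst P_sum1 k (last i (i :: t))).
by apply: eq_pexp => t' _; rewrite take_size_cat //= st.
Qed.

Lemma surv_short i n : (n.+1 < size w)%N -> surv i n = 1.
Proof.
move=> nw; rewrite /surv -[RHS](pexp_cst P_sum1 n i); apply: eq_pexp => t st.
by case: (boolP (infix _ _)) => // /size_infix /=; rewrite st leqNgt nw.
Qed.

Let first_hitE i n : first_hit i n = pexp P n i fresh.
Proof.
rewrite /first_hit fpsBE fps1E; case: n => [|n].
  rewrite fps_sub1X0 -[surv i 0%N]/((~~ infix w [:: i])%:R).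
  rewrite -[RHS]/((infix w [:: i])%:R - (infix w [::])%:R) infix_nil subr0.
  by case: infix; rewrite ?subr0 ?subrr.
rewrite fps_sub1XS sub0r opprB /surv -(pexp_take n 1) addn1 -pexpB.
apply: eq_pexp => t st; rewrite /fresh (_ : (size (i :: t)).-1 = n.+1) ?[size _]/= ?st //.
by case: (infix w (i :: t)); case: infix; rewrite [nat_of_bool _]/= ?subrr ?subr0 ?sub0r.
Qed.

Let sum_fresh n t : size t = n.+1 ->
  \sum_(k < n.+1) fresh (take k.+1 t) = (infix w t)%:R.
Proof.
move=> st; transitivity (\sum_(0 <= k < n.+1)
    ((infix w (take k.+1 t))%:R - (infix w (take k t))%:R : R)).
  rewrite big_mkord; apply: eq_bigr => k _.
  by rewrite /fresh size_takel ?st // take_takel.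
by rewrite telescope_sumr // take0 infix_nil subr0 -st take_size.
Qed.

(* Decomposition at the first occurrence: it ends in the letter [b], and only
   the last [size w] letters matter for the later ones. *)
Lemma renewal i : first_hit i * rehits = hits i.
Proof.
apply/funext => n; rewrite fpsME.
transitivity (pexp P n i
    (fun t => \sum_(k < n.+1) fresh (take k.+1 t) * (suffix w t)%:R)).
  rewrite pexp_sum; apply: eq_bigr => k _; rewrite first_hitE.
  have kn : (k <= n)%N by rewrite -ltnS.
  have split_n h : pexp P n i h = pexp P (k + (n - k)) i h by rewrite subnKC.
  rewrite split_n pexp_cat -pexpZr; apply: eq_pexp => t st.
  transitivity (fresh (i :: t) * pexp P (n - k) (last i (i :: t))
      (fun t' => (suffix w ((i :: t) ++ behead t'))%:R)); last first.
    by rewrite -pexpZ; apply: eq_pexp => t' _; rewrite take_size_cat //= st.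
  (* Only prefixes of the form [s ++ w] contribute, and [s] does not affect whether a longer word
     ends in [w]. *)
  rewrite fresh_suffix -!mulrA; congr (_ * _).
  case: (boolP (suffix w (i :: t))) => [/suffixP[s ts]|]; last by rewrite !mul0r.
  congr (_ * _); rewrite /rehits ts last_cat w_last; apply: eq_pexp => t' _ /=.
  by rewrite -catA (suffix_cat_long s) // size_cat leq_addr.
rewrite /hits; apply: eq_pexp => t st.
rewrite -mulr_suml sum_fresh ?[size _]/= ?st //.
case: (boolP (suffix w (i :: t))) => [/suffixW ->|]; first by rewrite mulr1.
by rewrite mulr0.
Qed.

(** The probability of being at [a] when an occurrence ending at time [n] must begin. Only [a] and
    the length of [w] enter, which makes two words comparable. *)
Definition shifted_visits i : fps R := fun n =>
  if (n < (size w).-1)%N then 0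
  else pexp P (n - (size w).-1) i (fun t => (last i t == a)%:R).

Lemma hits_short i n : (n < (size w).-1)%N -> hits i n = 0.
Proof.
move=> nw; rewrite /hits -[RHS](pexp0 P n i); apply: eq_pexp => t st.
case: (boolP (suffix w _)) => // /suffixW/size_infix /=; rewrite st; lia.
Qed.

Lemma hitsE i n : hits i n = shifted_visits i n * delta P w.
Proof.
rewrite /shifted_visits; case: ltnP => nw; first by rewrite hits_short ?mul0r.
rewrite /hits -{1}(subnK nw) pexp_cat -pexpZr; apply: eq_pexp => t st.
transitivity (pexp P (size w).-1 (last i (i :: t)) (fun t' => (t' == w)%:R)).
  apply: eq_pexp => t' st'; rewrite [behead _]/= (lastI i t) cat_rcons.
  rewrite suffix_cat_long; last by rewrite /= st'; lia.
  rewrite last_rcons suffixE /= st'; congr ((_ == _)%:R).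
  by rewrite (_ : _ - _ = 0)%N ?drop0 //; lia.
by rewrite pexp_eqword // w_head.
Qed.

(** An occurrence ending that late starts no earlier than the last letter of the copy already read,
    so only [b] matters. *)
Lemma rehits_long n : ((size w).-1 <= n)%N -> rehits n = hits b n.
Proof.
move=> nw; apply: eq_pexp => t st /=.
have -> : w ++ t = belast a (behead w) ++ (b :: t).
  rewrite -cat_rcons; congr cat.
  by case: (w) w_gt0 (w_head a) (w_last a) => //= x s _ -> <-; rewrite lastI.
by rewrite suffix_cat_long //= st; lia.
Qed.

(** The series [1 + psi]. For a word of length at least two it records the copies sharing at least
    two letters with the one just read, itself included; sharing a single letter is counted in
    [hits]. *)
Definition overlaps : fps R := rehits - hits b.

Lemma overlapsE n : overlaps n = if (n < (size w).-1)%N then rehits n else 0.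
Proof.
rewrite /overlaps fpsBE; case: ltnP => nw; first by rewrite hits_short ?subr0.
by rewrite rehits_long ?subrr.
Qed.

Lemma surv_rehits : (1 - fpsX R) * surv b * rehits = overlaps.
Proof.
have := renewal b; rewrite /overlaps => <-; rewrite /first_hit; ring.
Qed.

End Renewal.

(** * Overlaps of a word with itself and prime words *)

Section Overlaps.
Variables (R : realType) (N : nat) (P : 'M[R]_N) (w : seq 'I_N) (a b : 'I_N).
Hypothesis P_ge0 : forall i j, 0 <= P i j.
Hypothesis P_sum1 : forall i, \sum_j P i j = 1.
Hypothesis w_gt1 : (1 < size w)%N.
Hypothesis w_head : forall i, head i w = a.
Hypothesis w_last : forall i, last i w = b.
Implicit Types (i j : 'I_N) (t : seq 'I_N).

Let w_gt0 : (0 < size w)%N. Proof. exact: ltnW. Qed.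

Lemma overlaps_ge0 n : 0 <= overlaps P w b n.
Proof.
by rewrite (overlapsE _ w_gt0 w_head w_last); case: ifP => // _; apply: pexp_ge0.
Qed.

Lemma overlaps0 : overlaps P w b 0%N = 1.
Proof.
rewrite (overlapsE _ w_gt0 w_head w_last) ifT; last by lia.
by rewrite /rehits /= cats0 suffix_refl.
Qed.

(** A nonzero coefficient of positive index would match a proper suffix of [w] with a prefix. *)
Lemma overlaps_prime : prime_word w -> overlaps P w b = 1.
Proof.
move=> wP; apply/funext => n; rewrite fps1E; case: n => [|n]; first exact: overlaps0.
rewrite (overlapsE _ w_gt0 w_head w_last); case: ltnP => // nw.
rewrite /rehits -[RHS](pexp0 P n.+1 b); apply: eq_pexp => t st.
case: (boolP (suffix _ _)) => //=; rewrite suffixE size_cat st addKn.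
rewrite drop_cat ifT; last exact: leq_trans nw (leq_pred _).
move=> /eqP wE; have n_lt : (0 < n.+1 < size w)%N by lia.
case: (wP _ n_lt); rewrite -{3}wE take_size_cat // size_drop; lia.
Qed.

(** If [w] overlaps itself with shift [s], then repeating its last [s] letters after [w] completes a
    second copy. *)
Lemma overlaps_nonprime (A : 'I_N -> 'I_N -> bool) e : a <> b ->
  0 < e -> (forall i j, A i j -> e <= P i j) -> allowed_word A w ->
  ~ prime_word w -> exists2 s, (0 < s)%N & 0 < overlaps P w b s.
Proof.
move=> ab e0 eP [x [Ax [k wE]]] /existsNP[s] /not_implyP[/andP[s0 sw]] /contrapT dw.
have {}sw : (s < size w)%N := sw.
have {}dw : drop s w = take (size w - s) w := dw.
have nthw (i : nat) : (i < size w)%N -> nth a w i = x (k + i)%N.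
  by move=> iw; rewrite -wE size_mkseq in iw *; rewrite nth_mkseq.
have sb : nth a w (size w - s).-1 = b.
  rewrite -(w_last a) -(cat_take_drop s w) last_cat cat_take_drop dw.
  rewrite -nth_last size_takel ?leq_subr // nth_take //; last by lia.
  by apply: set_nth_default; lia.
(* An overlap of one letter would identify [a] with [b], so the shift lies in the range recorded by
   [overlaps]. *)
have s1 : (s < (size w).-1)%N.
  rewrite ltn_neqAle -ltnS prednK // sw andbT; apply/eqP => sE; apply: ab.
  rewrite -sb sE (_ : (_ - _).-1 = 0%N); last by lia.
  by rewrite nth0 w_head.
exists s => //; rewrite (overlapsE _ w_gt0 w_head w_last) s1.
(* [y] follows [w] from the end of the overlapping prefix, where the letter is [b]; its next [s]
   letters are the last ones of [w]. *)
pose y m := x (k + (size w - s).-1 + m)%N.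
have y0 : y 0%N = b by rewrite /y addn0 -nthw ?sb //; lia.
have yE : mkseq y s.+1 = drop (size w - s).-1 w.
  apply: (@eq_from_nth _ a); first by rewrite size_mkseq size_drop; lia.
  move=> i; rewrite size_mkseq => iS; rewrite nth_mkseq // nth_drop nthw ?addnA //.
  lia.
have Ay : in_SigmaA A y by move=> m; rewrite /y addnS; apply: Ax.
rewrite /rehits -y0.
apply: (lt_le_trans _ (pexp_path_ge P_ge0 s (ltW e0) eP Ay _)) => //.
rewrite yE mulr_gt0 ?exprn_gt0 // (_ : suffix _ _) //.
rewrite -drop1 drop_drop (_ : 1 + _ = size w - s)%N; last by lia.
rewrite -{2}(cat_take_drop s w) dw -catA cat_take_drop.
exact: suffix_suffix.
Qed.

Lemma surv_ge0 i n : 0 <= surv P w i n.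
Proof. exact: pexp_ge0. Qed.

Lemma surv_le1 i n : surv P w i n <= 1.
Proof.
rewrite -[leRHS](pexp_cst P_sum1 n i); apply: (le_pexp P_ge0) => t _.
by rewrite lern1 leq_b1.
Qed.

(** Occurrences straddling the two blocks are ignored, which can only increase the probability. *)
Lemma surv_cat i n k (c : R) : (forall j, surv P w j k <= c) ->
  surv P w i (n + k) <= surv P w i n * c.
Proof.
move=> kc; rewrite /surv pexp_cat -pexpZr; apply: (le_pexp P_ge0) => t _.
case: (boolP (infix w (i :: t))) => it; rewrite ?mul0r ?mul1r.
  rewrite -(pexp0 P k (last i (i :: t))); apply: (le_pexp P_ge0) => t' _.
  by rewrite infix_catr.
apply: le_trans (kc (last i (i :: t))); apply: (le_pexp P_ge0) => t' _.
have -> : (i :: t) ++ behead (last i (i :: t) :: t') =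
    belast i t ++ last i (i :: t) :: t' by rewrite -cat_rcons -lastI.
rewrite ler_nat; case: (boolP (infix w (last i (i :: t) :: t'))) => H; last exact: leq_b1.
by rewrite infix_catl.
Qed.

Lemma surv_nincr i : {homo surv P w i : m n / (m <= n)%N >-> n <= m}.
Proof.
move=> m n mn; rewrite -(subnKC mn) -[leRHS]mulr1; apply: surv_cat => j.
exact: surv_le1.
Qed.

Lemma first_hit_ge0 i n : 0 <= first_hit P w i n.
Proof.
rewrite /first_hit fpsBE fps1E; case: n => [|n].
  by rewrite fps_sub1X0 subr_ge0 surv_le1.
by rewrite fps_sub1XS sub0r opprB subr_ge0 surv_nincr.
Qed.

Variable p : 'rV[R]_N.
Hypothesis p_ge0 : forall i, 0 <= p 0 i.
Hypothesis p_sum1 : \sum_i p 0 i = 1.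
Hypothesis pP : p *m P = p.

Definition mass : fps R := fun n => \sum_i p 0 i * surv P w i n.

Lemma surv_le_mass i n : p 0 i * surv P w i n <= mass n.
Proof.
rewrite /mass (bigD1 i) //= lerDl; apply: sumr_ge0 => j _.
by rewrite mulr_ge0 ?surv_ge0.
Qed.

Lemma mass_le1 n : mass n <= 1.
Proof.
rewrite -p_sum1; apply: ler_sum => i _; rewrite -[leRHS]mulr1.
by apply: ler_wpM2l; rewrite ?surv_le1.
Qed.

Lemma mass_cat n k (c : R) : (forall j, surv P w j k <= c) ->
  mass (n + k) <= mass n * c.
Proof.
move=> kc; rewrite mulr_suml; apply: ler_sum => i _; rewrite -mulrA.
by apply: ler_wpM2l => //; apply: surv_cat.
Qed.

Let first_mass k : (1 - (1 - fpsX R) * mass) k = \sum_i p 0 i * first_hit P w i k.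
Proof.
rewrite /first_hit fpsBE fps1E; under eq_bigr do rewrite fpsBE fps1E mulrBr.
rewrite sumrB -mulr_suml p_sum1 mul1r; congr (_ - _).
case: k => [|k]; first by rewrite fps_sub1X0; under eq_bigr do rewrite fps_sub1X0.
rewrite fps_sub1XS; under eq_bigr do rewrite fps_sub1XS mulrBr.
by rewrite sumrB.
Qed.

Definition monomial (c : R) (m : nat) : fps R := fun n => if n == m then c else 0.

Lemma monomialM c m (f : fps R) n : (m <= n)%N ->
  (monomial c m * f) n = c * f (n - m)%N.
Proof.
move=> mn; rewrite fpsME; have mn' : (m < n.+1)%N by [].
rewrite (bigD1 (Ordinal mn')) //= {1}/monomial eqxx big1 ?addr0 // => i im.
by rewrite /monomial ifN ?mul0r.
Qed.

(** From the stationary start, [a] is visited with constant probability, so the occurrence series is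
    constant from index [(size w).-1] on and [1 - X] reduces it to a monomial. *)
Lemma mass_rehits : (1 - fpsX R) * (1 - (1 - fpsX R) * mass) * rehits P w b =
  monomial (delta P w * p 0 a) (size w).-1.
Proof.
have E n : ((1 - (1 - fpsX R) * mass) * rehits P w b) n =
    if (n < (size w).-1)%N then 0 else delta P w * p 0 a.
  rewrite fpsME; under eq_bigr do rewrite first_mass mulr_suml.
  rewrite exchange_big /=.
  transitivity (\sum_i p 0 i * hits P w i n).
    apply: eq_bigr => i _; rewrite -(renewal P_sum1 w_gt0 w_last) fpsME mulr_sumr.
    by apply: eq_bigr => k _; rewrite mulrA.
  under eq_bigr do rewrite (hitsE _ w_gt0 w_head) mulrA.
  rewrite -mulr_suml mulrC /shifted_visits; case: ifP => _.
    by rewrite big1 ?mulr0 // => i _; rewrite mulr0.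
  rewrite (pexp_stationary _ (fun i => (i == a)%:R) pP) (bigD1 a) //= eqxx mulr1.
  by rewrite big1 ?addr0 // => i /negPf ->; rewrite mulr0.
apply/funext => n; rewrite -mulrA /monomial; case: n => [|n].
  by rewrite fps_sub1X0 E ifT ?ifN //; lia.
by rewrite fps_sub1XS !E; case: ltngtP; rewrite ?subrr ?subr0.
Qed.

(** For a prime word [(1 - fpsX R) * surv P w b] is the inverse of [rehits], which therefore cancels
    in [mass_rehits]. *)
Lemma mass_prime : prime_word w -> 1 - (1 - fpsX R) * mass =
  monomial (delta P w * p 0 a) (size w).-1 * surv P w b.
Proof.
move=> /overlaps_prime wE; rewrite -mass_rehits.
have := surv_rehits P_sum1 w_gt0 w_last; rewrite wE => E.
rewrite -[LHS]mulr1 -[X in _ * X = _]E; ring.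
Qed.

Lemma mass_step n : prime_word w -> ((size w).-1 <= n.+1)%N ->
  mass n - mass n.+1 = delta P w * p 0 a * surv P w b (n.+1 - (size w).-1)%N.
Proof.
move=> wP nw; rewrite -monomialM // -mass_prime // fpsBE fps_sub1XS fps1E sub0r.
by rewrite opprB.
Qed.

End Overlaps.

(** * Trajectories of an irreducible matrix *)

Lemma fin_pos_lbound (R : realType) (T : finType) (f : T -> R) :
  (forall i, 0 < f i) -> exists2 c, 0 < c & forall i, c <= f i.
Proof.
move=> f0.
suff [c c0 cf] : exists2 c, 0 < c & forall i, i \in enum T -> c <= f i.
  by exists c => // i; apply: cf; rewrite mem_enum.
elim: (enum T) => [|i s [c c0 cs]]; first by exists 1.
exists (Num.min c (f i)); first by rewrite lt_min c0 f0.
move=> j; rewrite inE => /orP[/eqP ->|/cs cj]; first by rewrite ge_min lexx orbT.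
by rewrite ge_min cj.
Qed.

Section Trajectories.
Variables (N : nat) (A : 'I_N -> 'I_N -> bool).
Hypothesis Airr : irreducible_mx A.
Implicit Types (x y z : nat -> 'I_N).

Let glue_path i s y : path A i s -> last i s = y 0%N -> in_SigmaA A y ->
  exists z, [/\ in_SigmaA A z, z 0%N = i & forall m, z (size s + m)%N = y m].
Proof.
move=> + + Ay; elim: s i => [|c s IHs] i /=; first by move=> _ ->; exists y.
move=> /andP[ic cs] sy; have [z [Az z0 zE]] := IHs c cs sy.
by exists (fun m => if m is m'.+1 then z m' else i); split=> // -[|m] //=; rewrite z0.
Qed.

Lemma reach i y : in_SigmaA A y ->
  exists z k, [/\ in_SigmaA A z, z 0%N = i, (0 < k)%N & forall m, z (k + m)%N = y m].
Proof.
move=> Ay; have [c /andP[ic /connectP[s cs /esym sy]]] := Airr i (y 0%N).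
have [|z [Az z0 zE]] := @glue_path i (c :: s) y _ sy Ay; first by rewrite /= ic.
by exists z, (size (c :: s)).
Qed.

Lemma infix_mkseqP (u : seq 'I_N) y n : infix u (mkseq y n) ->
  exists q, mkseq (fun i => y (q + i)%N) (size u) = u.
Proof.
move=> /infixP[s [s' sE]]; exists (size s).
have sn : n = (size s + (size u + size s'))%N.
  by rewrite -(size_mkseq y n) sE !size_cat.
case: u sE sn => [//|c u']; set u := c :: u' => sE sn.
apply: (@eq_from_nth _ c); rewrite size_mkseq // => i iu.
rewrite nth_mkseq //.
have : nth c (mkseq y n) (size s + i) = nth c (s ++ u ++ s') (size s + i) by rewrite sE.
rewrite nth_mkseq; last by rewrite sn ltn_add2l ltn_addr.
by rewrite nth_cat ifN -?leqNgt ?leq_addr // addKn nth_cat iu.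
Qed.

(* Follow [w] and then any way back to its first letter; the periodic
   trajectory repeating this walk up to its first return avoids [u]: a period
   shorter than [u] contradicts primality, and otherwise the first letter
   occurs once per period, at the beginning of [w]. *)
Lemma avoiding_trajectory (u w : seq 'I_N) a : prime_word u -> (0 < size u)%N ->
  (forall i, head i u = a) -> (forall i, head i w = a) ->
  size w = size u -> allowed_word A w -> u <> w ->
  exists2 y, in_SigmaA A y & forall n, ~~ infix u (mkseq y n).
Proof.
move=> uP u0 ua wa swu [x [Ax [k0 wE]]] uw.
pose x0 m := x (k0 + m)%N.
have Ax0 : in_SigmaA A x0 by move=> m; rewrite /x0 addnS.
have wE0 i : (i < size u)%N -> x0 i = nth a w i.
  by move=> iu; rewrite -[in RHS]wE nth_mkseq ?swu.
have x0a : x0 0%N = a by rewrite wE0 // nth0 wa.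
have [z [k1 [Az z0 k1_gt0 zE]]] := reach (x0 (size u).-1) Ax0.
pose x1 m := if (m < (size u).-1)%N then x0 m else z (m - (size u).-1)%N.
have x1E m : (m < size u)%N -> x1 m = x0 m.
  move=> mu; rewrite /x1; case: ltnP => // um.
  have -> : m = (size u).-1 by lia.
  by rewrite subnn z0.
have Ax1 : in_SigmaA A x1.
  move=> m; have [mu|um] := ltnP m.+1 (size u).
    by rewrite !x1E //; apply: ltnW.
  rewrite /x1 [X in A _ (if X then _ else _)]ltnNge (_ : (_ <= m.+1)%N) /=; last by lia.
  case: ltnP => mu; last by rewrite subSn //.
  have -> : m.+1 = (size u).-1 by lia.
  rewrite subnn z0 (_ : (size u).-1 = m.+1); [exact: Ax0|lia].
have ret : exists k, (0 < k)%N && (x1 k == a).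
  exists ((size u).-1 + k1)%N; rewrite ltn_addl //= /x1 ltnNge leq_addr /= addKn.
  by rewrite -[k1]addn0 zE x0a.
case: (ex_minnP ret) => k /andP[k_gt0 /eqP x1k] kmin.
have x10 : x1 0%N = a by rewrite x1E.
pose y m := x1 (m %% k)%N.
exists y => [m|n].
  rewrite /y modnS; case: ifP => [km|_]; last exact: Ax1.
  (* At the end of a period the step leads to [x1 0], which equals [x1 k], so it is a transition of
     [x1]. *)
  rewrite x10 -x1k; have := Ax1 (m %% k)%N; congr (A _ (x1 _)).
  move: km; rewrite {1}(divn_eq m k) -addnS dvdn_addr ?dvdn_mull // => km.
  by apply/eqP; rewrite eqn_leq ltn_pmod //= dvdn_leq.
apply/negP => /infix_mkseqP[q qu].
have uE i : (i < size u)%N -> y (q + i)%N = nth a u i.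
  by move=> iu; rewrite -[in RHS]qu nth_mkseq.
have [ku|uk] := ltnP k (size u).
  apply: (uP k); first by rewrite k_gt0.
  apply: (@eq_from_nth _ a); rewrite size_drop ?size_takel ?leq_subr // => i iu.
  rewrite nth_drop nth_take // -!uE; [|lia|lia].
  by rewrite /y addnCA modnDl.
apply: uw; apply: (@eq_from_nth _ a) => // i iu.
have qk : (q %% k = 0)%N.
  apply/eqP; rewrite -leqn0 leqNgt; apply/negP => q_gt0.
  have := kmin (q %% k)%N; rewrite q_gt0 /= leqNgt ltn_pmod //=.
  suff -> : x1 (q %% k)%N == a by move/(_ isT).
  by rewrite -[q]addn0 -/(y _) uE // nth0 ua.
rewrite -uE // -wE0 // /y -modnDml qk add0n modn_small ?x1E //; lia.
Qed.

End Trajectories.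

(** * Positivity and geometric decay for the irreducible chain *)

Section MarkovPositivity.
Variables (R : realType) (N : nat) (A : 'I_N -> 'I_N -> bool) (P : 'M[R]_N).
Hypothesis Airr : irreducible_mx A.
Hypothesis AP : compatible_stochastic A P.

Lemma transition_lbound :
  exists2 e, 0 < e & forall i j, A i j -> e <= P i j.
Proof.
have [_ [_ PA]] := AP.
have [|e e0 eP] := @fin_pos_lbound R ('I_N * 'I_N)%type
    (fun ij => if A ij.1 ij.2 then P ij.1 ij.2 else 1).
  by move=> [i j] /=; rewrite -PA; case: ifP.
by exists e => // i j Aij; have := eP (i, j); rewrite /= Aij.
Qed.

(** Some letter has positive mass, and positivity propagates along allowed transitions. *)
Lemma stationary_gt0 (p : 'rV[R]_N) : stationary_vector P p -> forall i, 0 < p 0 i.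
Proof.
have [P0 [_ PA]] := AP; move=> [p0 [p1 pP]].
have step i j : A i j -> 0 < p 0 i -> 0 < p 0 j.
  move=> Aij pi; rewrite (_ : p 0 j = (p *m P) 0 j) ?[in RHS]pP // mxE (bigD1 i) //=.
  rewrite ltr_pwDl ?mulr_gt0 ?PA //; apply: sumr_ge0 => l _; exact: mulr_ge0.
have [i0 pi0] : exists i, 0 < p 0 i.
  apply: contrapT => /forallNP pn; have /eqP := p1; rewrite big1.
    by rewrite eq_sym oner_eq0.
  by move=> i _; apply/eqP; rewrite eq_le p0 andbT leNgt; apply/negP/pn.
move=> j; have [c /andP[ic /connectP[s cs ->]]] := Airr i0 j.
have := step _ _ ic pi0; elim: s c {ic} cs => [|d s IHs] c //= /andP[cd ds] pc.
by apply: IHs => //; apply: step pc.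
Qed.

Lemma surv_decay (w : seq 'I_N) : allowed_word A w ->
  exists K c, [/\ 0 < c, c < 1 & forall j, surv P w j K <= c].
Proof.
move=> [x [Ax [k0 wE]]]; have [P0 [P1 PA]] := AP; have [e e0 eP] := transition_lbound.
pose x0 m := x (k0 + m)%N.
have Ax0 : in_SigmaA A x0 by move=> m; rewrite /x0 addnS.
have lt1 j : exists k, surv P w j k < 1.
  have [z [k [Az z0 _ zE]]] := reach Airr j Ax0.
  exists (k + size w)%N.
  have -> : surv P w j (k + size w)%N =
      1 - pexp P (k + size w) j (fun t => (infix w t)%:R).
    rewrite -{1}(pexp_cst P1 (k + size w) j 1) -pexpB; apply: eq_pexp => t _.
    by case: infix; rewrite ?subrr ?subr0.
  rewrite ltrBlDr ltrDl -z0.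
  apply: (lt_le_trans _ (pexp_path_ge P0 _ (ltW e0) eP Az _)) => //.
  rewrite mulr_gt0 ?exprn_gt0 // (_ : infix _ _) //.
  apply/infixP; exists (mkseq z k), [:: z (k + size w)%N].
  rewrite /mkseq -addn1 -addnA !iotaD !map_cat; congr (_ ++ (_ ++ _)).
  rewrite add0n -[RHS]wE -{1}[k]addn0 iotaDl -map_comp.
  by apply: eq_map => i /=; rewrite zE.
have [k kj] := choice lt1.
(* Survival decreases in time, so one time above all [k j] serves every starting letter. *)
pose K := (\sum_j k j)%N.
have [|c c0 cK] := @fin_pos_lbound R 'I_N (fun j => 1 - surv P w j K).
  move=> j; rewrite subr_gt0; apply: le_lt_trans (kj j).
  by apply: surv_nincr => //; rewrite /K (bigD1 j) //= leq_addr.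
(* The maximum with [1 / 2] keeps the bound positive, so that its logarithm can be used. *)
exists K, (Num.max (1 - c) (1 / 2)); split=> [||j].
- by rewrite lt_max; apply/orP; right; lra.
- by rewrite gt_max; apply/andP; split; lra.
- by rewrite le_max; apply/orP; left; have := cK j; lra.
Qed.

End MarkovPositivity.

(** * The measure of the survivor sets as a path expectation *)

Section MeasureOfSurvivors.
Variables (R : realType) (N : nat) (P : 'M[R]_N) (p : 'rV[R]_N).

Let sum_tuple n (F : seq 'I_N -> R) :
  \sum_(t : n.+1.-tuple 'I_N) F t = \sum_i \sum_(t : n.-tuple 'I_N) F (i :: t).
Proof.
rewrite pair_big /= (reindex (fun it : 'I_N * n.-tuple 'I_N => [tuple of it.1 :: it.2])) //.
exists (fun t => (thead t, [tuple of behead t])) => [[i t] _|t _] /=.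
  by congr pair; apply: val_inj.
by rewrite [t in RHS]tuple_eta.
Qed.

Let sum_delta n i (h : seq 'I_N -> R) :
  \sum_(t : n.-tuple 'I_N) delta P (i :: t) * h (i :: t) = pexp P n i h.
Proof.
elim: n i h => [|n IHn] i h /=.
  rewrite (big_pred1 [tuple]) => [|t]; last by apply/esym/eqP; rewrite [t]tuple0.
  by rewrite /delta big_nil mul1r.
rewrite (sum_tuple n (fun t => delta P (i :: t) * h (i :: t))).
apply: eq_bigr => j _; rewrite -IHn mulr_sumr; apply: eq_bigr => t _.
by rewrite mulrA /delta /= big_cons.
Qed.

Let sum_mu_cyl k n (Q : pred (seq 'I_N)) : k = n.+1 ->
  \sum_(t : k.-tuple 'I_N | Q t) mu_cyl P p t =
  \sum_i p 0 i * pexp P n i (fun t => (Q t)%:R).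
Proof.
move=> ->; rewrite big_mkcond /=.
rewrite (sum_tuple n (fun t => if Q t then mu_cyl P p t else 0)).
apply: eq_bigr => i _; rewrite -sum_delta mulr_sumr; apply: eq_bigr => t _ /=.
by case: (Q _); rewrite ?mulr1 ?mulr0.
Qed.

(** The positions [i <= m] are exactly those at which [w] fits into [t]. *)
Let avoidE (w t : seq 'I_N) m : size t = (m + size w)%N ->
  [forall i : 'I_m.+1, take (size w) (drop i t) != w] = ~~ infix w t.
Proof.
move=> st; apply/forallP/idP => [H|/negP H i]; last first.
  apply/eqP => wE; apply: H; apply/infixP.
  by exists (take i t), (drop (size w) (drop i t)); rewrite -{1}wE !cat_take_drop.
apply/negP => /infixP[s [s' tE]].
have sm : (size s < m.+1)%N.
  by rewrite ltnS -(leq_add2r (size w)) -st tE !size_cat addnA leq_addr.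
by have := H (Ordinal sm); rewrite tE /= drop_size_cat // take_size_cat // eqxx.
Qed.

Lemma mu_WE (w : seq 'I_N) m : (0 < size w)%N ->
  mu_W P p w m = mass P w p (m + (size w).-1)%N.
Proof.
move=> w0; rewrite /mu_W; have E : (m + size w = (m + (size w).-1).+1)%N by lia.
rewrite (sum_mu_cyl (fun t => [forall i : 'I_m.+1, take (size w) (drop i t) != w]) E).
apply: eq_bigr => i _; congr (_ * _); apply: eq_pexp => t st.
by rewrite avoidE //= st E.
Qed.

End MeasureOfSurvivors.

(** * Comparison of two words *)

Section Comparison.
Variables (R : realType) (N : nat) (P : 'M[R]_N) (u w : seq 'I_N) (a b : 'I_N).
Hypothesis P_ge0 : forall i j, 0 <= P i j.
Hypothesis P_sum1 : forall i, \sum_j P i j = 1.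
Hypothesis u_gt1 : (1 < size u)%N.
Hypothesis size_wu : size w = size u.
Hypothesis u_head : forall i, head i u = a.
Hypothesis u_last : forall i, last i u = b.
Hypothesis w_head : forall i, head i w = a.
Hypothesis w_last : forall i, last i w = b.
Hypothesis delta_wu : delta P w = delta P u.
Hypothesis uP : prime_word u.

Let u_gt0 : (0 < size u)%N. Proof. exact: ltnW. Qed.
Let w_gt0 : (0 < size w)%N. Proof. by rewrite size_wu. Qed.
Let w_gt1 : (1 < size w)%N. Proof. by rewrite size_wu. Qed.

Lemma hits_eq i : hits P w i = hits P u i.
Proof.
apply/funext => n; rewrite (hitsE P w_gt0 w_head) (hitsE P u_gt0 u_head).
by rewrite /shifted_visits size_wu delta_wu.
Qed.

Lemma surv_compare : surv P w b =
  surv P u b + surv P u b * (overlaps P w b - 1) * first_hit P w b.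
Proof.
have Eu := surv_rehits P_sum1 u_gt0 u_last.
have Ew := surv_rehits P_sum1 w_gt0 w_last.
have Ru : rehits P u b = hits P u b + 1.
  by rewrite -(overlaps_prime P u_gt1 u_head u_last uP) /overlaps addrC subrK.
have Rw : rehits P w b = hits P u b + overlaps P w b.
  by rewrite -hits_eq /overlaps addrC subrK.
rewrite (overlaps_prime P u_gt1 u_head u_last uP) Ru in Eu.
rewrite Rw in Ew.
rewrite /first_hit.
apply/eqP; rewrite -subr_eq0; apply/eqP.
(* The difference is a combination of the two renewal equations, so no series has to be inverted. *)
transitivity (surv P w b * (1 - (1 - fpsX R) * surv P u b * (hits P u b + 1))
  - surv P u b * (overlaps P w b - (1 - fpsX R) * surv P w b *
                    (hits P u b + overlaps P w b))); first by ring.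
by rewrite Eu Ew !subrr !mulr0 subrr.
Qed.

Lemma overlaps_sub1_ge0 n : 0 <= (overlaps P w b - 1) n.
Proof.
rewrite fpsBE fps1E; case: n => [|n].
  by rewrite (overlaps0 P w_gt1 w_head w_last) subrr.
by rewrite subr0 (overlaps_ge0 P_ge0 w_gt1 w_head w_last).
Qed.

(** Only the coefficient [s] of [overlaps P w b - 1] is kept in [surv_compare]; the other terms are
    nonnegative. *)
Lemma surv_gain s n : (0 < s)%N -> (s <= n)%N ->
  surv P u b n + overlaps P w b s *
    \sum_(k < (n - s).+1) first_hit P w b k * surv P u b (n - s - k)%N
  <= surv P w b n.
Proof.
move=> s0 sn; rewrite [in leRHS]surv_compare fpsDE lerD2l.
rewrite (_ : surv P u b * _ * _ =
  (overlaps P w b - 1) * (first_hit P w b * surv P u b)); last by ring.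
rewrite fpsME.
have sn' : (s < n.+1)%N by [].
rewrite (bigD1 (Ordinal sn')) //= -[leLHS]addr0; apply: lerD.
  by rewrite fpsBE fps1E gtn_eqF // subr0 fpsME.
apply: sumr_ge0 => i _; rewrite mulr_ge0 ?overlaps_sub1_ge0 //.
rewrite fpsME; apply: sumr_ge0 => j _.
by rewrite mulr_ge0 ?surv_ge0 ?first_hit_ge0.
Qed.

Lemma surv_le n : surv P u b n <= surv P w b n.
Proof.
rewrite [in leRHS]surv_compare fpsDE lerDl fpsME; apply: sumr_ge0 => i _.
rewrite mulr_ge0 ?first_hit_ge0 // fpsME; apply: sumr_ge0 => j _.
by rewrite mulr_ge0 ?surv_ge0 ?overlaps_sub1_ge0.
Qed.

(** With [psi = 0] the survival series from [b] agree, hence so do the right-hand sides of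
    [mass_prime]; the induction divides by [1 - X]. *)
Lemma mass_eq (p : 'rV[R]_N) : stationary_vector P p -> prime_word w ->
  mass P w p = mass P u p.
Proof.
move=> [p0 [p1 pP]] wP.
have Sb : surv P w b = surv P u b.
  rewrite surv_compare (overlaps_prime P w_gt1 w_head w_last wP) subrr.
  by rewrite mulr0 mul0r addr0.
have := mass_prime P_sum1 w_gt1 w_head w_last p1 pP wP.
rewrite Sb delta_wu size_wu -(mass_prime P_sum1 u_gt1 u_head u_last p1 pP uP) => E.
apply/funext => n; elim: n => [|n IHn].
  have := congr1 (fun f : fps R => f 0%N) E.
  by rewrite !fpsBE !fps_sub1X0; lra.
have := congr1 (fun f : fps R => f n.+1) E.
by rewrite !fpsBE !fps_sub1XS IHn; lra.
Qed.

End Comparison.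

(** * Exponential growth rates *)

Section GrowthRates.
Variable R : realType.
Implicit Types (a : nat -> R) (L : R).
Local Open Scope classical_set_scope.
Local Open Scope ring_scope.

Lemma natmul_bounded_le0 (x B : R) : (forall i : nat, i%:R * x <= B) -> x <= 0.
Proof.
move=> iB; rewrite leNgt; apply/negP => x0.
have := iB (Num.truncn (B / x)).+1; apply/negP; rewrite -ltNge -ltr_pdivrMr //.
exact: truncnS_gt.
Qed.

(** Convergence of [a n / n] to [L] in a division-free form valid for every [n], which reduces
    shifts and comparisons to linear arithmetic. *)
Definition rate a L :=
  forall e, 0 < e -> exists M, forall n, `|a n - n%:R * L| <= e * n%:R + M.

Lemma rate_cvg a L : rate a L -> (fun n => a n / n%:R) @ \oo --> L.
Proof.
move=> aL; apply/cvgrPdist_le => e e0; have e2 : 0 < e / 2 by lra.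
have [M aM] := aL _ e2.
exists (Num.truncn (M / (e / 2))).+1 => // n /= nM.
have n0 : 0 < n%:R :> R by rewrite ltr0n; apply: leq_trans nM.
rewrite -(ler_pM2r n0) -[X in _ * X <= _](gtr0_norm n0) -normrM mulrBl divfK ?gt_eqF //.
rewrite distrC mulrC [L * _]mulrC in aM *; apply: le_trans (aM n) _.
have : M < (e / 2) * n%:R.
  rewrite mulrC -ltr_pdivrMr //; apply: lt_le_trans (truncnS_gt _) _.
  by rewrite ler_nat.
lra.
Qed.

Lemma rate_shift a L d : rate a L -> rate (fun n => a (n + d)%N) L.
Proof.
move=> aL e e0; have [M aM] := aL _ e0; exists (e * d%:R + M + d%:R * `|L|) => n.
have := aM (n + d)%N; rewrite natrD.
have := ler_norm (d%:R * L); have := ler_norm (- (d%:R * L)).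
rewrite normrN normrM ger0_norm // !ler_norml !mulrDr !mulrDl; lra.
Qed.

Lemma rate_le a a' L L' B : rate a L -> rate a' L' ->
  (forall n, a n <= a' n + B) -> L <= L'.
Proof.
move=> aL aL' aa'; apply/ler_addgt0Pr => e e0; have e2 : 0 < e / 2 by lra.
have [M aM] := aL _ e2; have [M' aM'] := aL' _ e2.
rewrite -lerBlDr -subr_le0; apply: (@natmul_bounded_le0 _ (M + M' + B)) => n.
have := aM n; have := aM' n; have := aa' n; rewrite !ler_norml !mulrBr; lra.
Qed.

(** The sequence [a n + C] is subadditive; its rate is the infimum of [(a n + C) / n], finite by the
    linear lower bound. *)
Lemma fekete a C B : (forall n k, a (n + k)%N <= a n + a k + C) ->
  (forall n, - (B * n%:R) - B <= a n) ->
  exists2 L, rate a L & forall n, n%:R * L <= a n + C.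
Proof.
move=> asub alb.
have mulb n q : a (q.+1 * n)%N + C <= q.+1%:R * (a n + C).
  elim: q => [|q IHq]; first by rewrite mul1n mul1r.
  rewrite mulSn -(natr1 q.+1) mulrDl mul1r; have := asub n (q.+1 * n)%N; lra.
pose S := [set x | exists2 n, (0 < n)%N & x = (a n + C) / n%:R].
have infS : has_inf S.
  split; first by exists ((a 1%N + C) / 1%:R), 1%N.
  exists (- `|B| - `|B| - `|C|) => x [n n0 ->].
  have n1 : 1 <= n%:R :> R by rewrite ler1n.
  rewrite ler_pdivlMr; last by lra.
  have := alb n; have := ler_norm (- C); have := ler_norm B; rewrite normrN => B1 C1.
  have := normr_ge0 B; have := normr_ge0 C; nra.
pose L := inf S.
have Llb n : n%:R * L <= a n + C.
  case: n => [|n]; first by have := asub 0%N 0%N; rewrite addn0 mul0r; lra.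
  rewrite mulrC -ler_pdivlMr ?ltr0n //; apply: ge_inf; first by have [] := infS.
  by exists n.+1.
exists L => // e e0; have [x [n n0 ->] xL] := inf_adherent e0 infS.
rewrite -/L ltr_pdivrMr ?ltr0n // in xL.
pose M0 := \sum_(r < n) `|a r|.
exists (M0 + `|C| + n%:R * `|L + e|) => m.
(* Euclidean division of [m] by the near-optimal [n]: [M0] bounds the contribution of every possible
   remainder. *)
have [ar arM0] : exists2 r, (r < n)%N & `|a r| <= M0 /\ (m %% n = r)%N.
  exists (m %% n)%N; first by rewrite ltn_mod.
  split=> //; have mn : (m %% n < n)%N by rewrite ltn_mod.
  by rewrite /M0 (bigD1 (Ordinal mn)) //= lerDl sumr_ge0.
move=> [aM0 mr].
have mE : m%:R = (m %/ n)%:R * n%:R + ar%:R :> R.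
  by rewrite -mr -natrM -natrD -divn_eq.
have qa : a m <= (m %/ n)%:R * (a n + C) + a ar.
  rewrite {1}(divn_eq m n) mr; case: (m %/ n)%N => [|q]; first by rewrite mul0r add0r.
  have := mulb n q; have := asub (q.+1 * n)%N ar; lra.
have q0 : 0 <= (m %/ n)%:R :> R by [].
have arn : ar%:R <= n%:R :> R by rewrite ler_nat ltnW.
have ar0 : 0 <= ar%:R :> R by [].
have qn : (m %/ n)%:R * (a n + C) <= (m %/ n)%:R * ((L + e) * n%:R).
  by apply: ler_wpM2l => //; apply: ltW.
have arL : - (ar%:R * (L + e)) <= n%:R * `|L + e|.
  rewrite -mulrN; apply: le_trans (ler_wpM2r (normr_ge0 _) arn).
  by apply: ler_wpM2l => //; rewrite -normrN ler_norm.
have := Llb m; have := ler_norm C; have := normr_ge0 C; have := ler_norm (a ar).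
have M00 : 0 <= M0 by exact: sumr_ge0.
have nL0 : 0 <= n%:R * `|L + e| by rewrite mulr_ge0.
have em0 : 0 <= e * m%:R by rewrite mulr_ge0 // ltW.
have mLe : m%:R * (L + e) = (m %/ n)%:R * ((L + e) * n%:R) + ar%:R * (L + e).
  rewrite mE; ring.
move: mLe; rewrite ler_norml mulrDr [m%:R * e]mulrC => *; apply/andP; split; lra.
Qed.

(* With [v n = V n / expR L ^+ n] and [t n] the partial sums of [v], the
   hypotheses give [v (j + s) + c v j >= c' * t j], hence geometric growth of
   [t], against the subexponential growth of [v]. *)
Lemma renewal_strict (U V F : nat -> R) (L c phi : R) s : L < 0 -> 0 < c -> 0 < phi ->
  (forall n, c * expR L ^+ n <= U n) -> (forall n, 0 <= V n) -> V 0%N = 1 ->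
  F 0%N = 0 -> (forall n, F n.+1 = V n - V n.+1) -> (forall n, 0 <= F n) ->
  (forall n, phi * \sum_(k < n.+1) F k * U (n - k)%N <= V (n + s)%N) ->
  (forall e, 0 < e -> exists M, forall n, V n <= expR (n%:R * L + e * n%:R + M)) ->
  False.
Proof.
move=> L0 c0 phi0 Ulb V0 V01 F0 FS F_ge0 VF Vub.
pose q := expR L; have q0 : 0 < q by exact: expR_gt0.
(* Negativity of the rate makes the coefficient [q^-1 - 1] of [t] positive below. *)
have q1 : q < 1 by rewrite expR_lt1.
pose v n := V n / q ^+ n; pose t n := \sum_(k < n) v k.
have qn0 n : 0 < q ^+ n by exact: exprn_gt0.
have v0 n : 0 <= v n by rewrite divr_ge0 // ltW.
have tS n : t n.+1 = t n + v n by rewrite /t big_ord_recr.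
have t_ge0 n : 0 <= t n by exact: sumr_ge0.
have tle m n : t m <= t (m + n)%N.
  by elim: n => [|n IHn]; rewrite ?addn0 // addnS tS; have := v0 (m + n)%N; lra.
(* Summation by parts, [F] being the drops of [V]. *)
have G n : \sum_(k < n.+1) F k / q ^+ k = 1 + (q^-1 - 1) * t n - v n.
  elim: n => [|n IHn].
    by rewrite big_ord1 F0 mul0r /t big_ord0 /v V01 expr0 divr1; ring.
  rewrite big_ord_recr /= IHn tS FS /v exprS invfM; ring.
pose c1 := phi * c / q ^+ s; have c10 : 0 < c1 by rewrite divr_gt0 // mulr_gt0.
have key j : c1 * ((q^-1 - 1) * t j) <= v (j + s)%N + c1 * v j.
  suff : c1 * (1 + (q^-1 - 1) * t j - v j) <= v (j + s)%N.
    by rewrite mulrBr mulrDr; lra.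
  rewrite -G /v exprD invfM mulrA ler_pdivlMr // ler_pdivlMr //.
  apply: le_trans (VF j).
  have -> : c1 * (\sum_(k < j.+1) F k / q ^+ k) * q ^+ s * q ^+ j =
      phi * \sum_(k < j.+1) F k * (c * q ^+ (j - k)).
    have c1E : c1 * q ^+ s = phi * c by rewrite divfK ?gt_eqF.
    transitivity (c1 * q ^+ s * ((\sum_(k < j.+1) F k / q ^+ k) * q ^+ j)).
      by ring.
    rewrite c1E -mulrA mulr_suml mulr_sumr; congr (_ * _); apply: eq_bigr => k _.
    have kj : (k <= j)%N by rewrite -ltnS.
    have -> : q ^+ j = q ^+ (j - k) * q ^+ k by rewrite -exprD subnK.
    by field; rewrite gt_eqF.
  by apply: ler_wpM2l; [exact: ltW|apply: ler_sum => k _; apply: ler_wpM2l].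
pose eta := c1 * (q^-1 - 1) / (1 + c1).
have qi : 1 < q^-1 by rewrite invf_gt1.
have eta0 : 0 < eta.
  by rewrite divr_gt0 //; [rewrite mulr_gt0 // subr_gt0|rewrite addr_gt0].
(* Both [v j] and [v (j + s)] are increments of [t] within the next [s + 1] steps, so [key] forces a
   fixed relative growth. *)
have grow j : (1 + eta) * t j <= t (j + s.+1)%N.
  have A1 : t j + v (j + s)%N <= t (j + s.+1)%N by rewrite addnS tS lerD2r tle.
  have A2 : t j + v j <= t (j + s.+1)%N by rewrite -tS -addSnnS tle.
  have A3 : (1 + c1) * (eta * t j) <= (1 + c1) * (t (j + s.+1)%N - t j).
    have -> : (1 + c1) * (eta * t j) = c1 * ((q^-1 - 1) * t j).
      by rewrite mulrA [_ * eta]mulrC divfK ?mulrA // gt_eqF // addr_gt0.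
    apply: le_trans (key j) _.
    have c1v : c1 * v j <= c1 * (t (j + s.+1)%N - t j) by rewrite ler_pM2l //; lra.
    by rewrite [leRHS]mulrDl mul1r; apply: lerD => //; lra.
  by move: A3; rewrite ler_pM2l ?addr_gt0 //; lra.
have lb i : (1 + eta) ^+ i <= t (1 + i * s.+1)%N.
  elim: i => [|i IHi]; first by rewrite tS /t big_ord0 add0r /v V01 divr1.
  rewrite exprS mulSn [(s.+1 + _)%N]addnC addnA; apply: le_trans (grow _).
  by apply: ler_wpM2l => //; lra.
pose th := ln (1 + eta); have th0 : 0 < th by rewrite ln_gt0 //; lra.
have s0 : 0 < s.+1%:R :> R by rewrite ltr0n.
(* The factor 4 makes the upper bound on [ln (t n)] grow by only [th / 2] every [s + 1] steps,
   against the [th] forced by [lb]. *)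
have [e e0 eE] : exists2 e, 0 < e & e * (4 * s.+1%:R) = th.
  exists (th / (4 * s.+1%:R)); first by rewrite divr_gt0 // mulr_gt0.
  by rewrite divfK // mulf_neq0 // gt_eqF.
have [M VM] := Vub _ e0.
have vM n : v n <= expR (e * n%:R + M).
  rewrite /v ler_pdivrMr // /q -expRM_natl -expRD; apply: le_trans (VM n) _.
  by rewrite ler_expR; lra.
(* The number of terms is absorbed by [n <= expR (e * n) / e]. *)
have tM n : t n <= expR (2 * e * n%:R + M) / e.
  have -> : 2 * e * n%:R + M = e * n%:R + (e * n%:R + M) by ring.
  rewrite expRD; apply: (@le_trans _ _ (n%:R * expR (e * n%:R + M))).
    have -> : n%:R * expR (e * n%:R + M) = \sum_(k < n) expR (e * n%:R + M).
      by rewrite sumr_const card_ord mulr_natl.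
    apply: ler_sum => k _.
    apply: le_trans (vM k) _; rewrite ler_expR lerD2r ler_pM2l // ler_nat.
    exact: ltnW.
  rewrite mulrAC; apply: ler_wpM2r; first exact: expR_ge0.
  by rewrite ler_pdivlMr // mulrC; have := expR_ge1Dx (e * n%:R); lra.
suff : th / 2 <= 0 by lra.
apply: (@natmul_bounded_le0 _ (2 * e + M - ln e)) => i.
have := le_trans (lb i) (tM _).
rewrite -ler_ln ?posrE ?exprn_gt0 ?divr_gt0 ?expR_gt0 //; last by lra.
rewrite lnXn; last by lra.
rewrite ln_div ?posrE ?expR_gt0 // expRK -[X in X <= _ -> _]mulr_natl -/th.
have -> : 2 * e * (1 + i * s.+1)%N%:R = 2 * e + i%:R * (th / 2).
  by rewrite natrD natrM -eE; field.
lra.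
Qed.

End GrowthRates.

(** * Escape rates *)

Section EscapeRates.
Variables (R : realType) (N : nat) (A : 'I_N -> 'I_N -> bool) (P : 'M[R]_N).
Variable p : 'rV[R]_N.
Hypothesis Airr : irreducible_mx A.
Hypothesis AP : compatible_stochastic A P.
Hypothesis pP : stationary_vector P p.

Let P_ge0 i j : 0 <= P i j. Proof. by have [] := AP. Qed.
Let P_sum1 i : \sum_j P i j = 1. Proof. by have [_ []] := AP. Qed.
Let p_gt0 : forall i, 0 < p 0 i. Proof. exact: stationary_gt0 pP. Qed.
Let p_ge0 i : 0 <= p 0 i. Proof. exact: ltW. Qed.

Lemma rho_rate w L : (0 < size w)%N -> rate (fun n => ln (mass P w p n)) L ->
  rho P p w = - L.
Proof.
move=> w0 wL; rewrite /rho; congr (- _); apply/cvg_lim => //.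
under eq_fun do rewrite mu_WE //.
exact/rate_cvg/(rate_shift (size w).-1 wL).
Qed.

(** Survival from [j] is at most [mass] divided by [p 0 j], so [ln] of [mass] is subadditive up to
    [- ln c], with [c] a lower bound for [p]. *)
Lemma mass_rate w d e : 0 < d -> 0 < e -> (forall n, d * e ^+ n <= mass P w p n) ->
  exists2 L, rate (fun n => ln (mass P w p n)) L &
    exists C, forall n, n%:R * L <= ln (mass P w p n) + C.
Proof.
move=> d0 e0 lb; have [c c0 cp] := fin_pos_lbound p_gt0.
have m0 n : 0 < mass P w p n.
  by apply: lt_le_trans (lb n); rewrite mulr_gt0 ?exprn_gt0.
have [n k|n|L wL LC] := @fekete R (fun n => ln (mass P w p n)) (- ln c)
    (`|ln d| + `|ln e|).
- rewrite -lnV ?posrE // -!lnM ?posrE ?mulr_gt0 ?invr_gt0 // ler_ln ?posrE //; last first.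
    by rewrite !mulr_gt0 ?invr_gt0.
  rewrite -mulrA; apply: mass_cat => // j.
  rewrite ler_pdivlMr //; apply: le_trans (surv_le_mass _ P_ge0 p_ge0 j k).
  by rewrite mulrC; apply: ler_wpM2r; rewrite ?surv_ge0.
- have : ln (d * e ^+ n) <= ln (mass P w p n).
    by rewrite ler_ln ?posrE ?mulr_gt0 ?exprn_gt0.
  rewrite lnM ?posrE ?exprn_gt0 // lnXn // -[ln e *+ n]mulr_natl; apply: le_trans.
  have := ler_norm (- ln d); have := ler_norm (- ln e); rewrite !normrN.
  have := normr_ge0 (ln d); have := normr_ge0 (ln e).
  have : 0 <= n%:R :> R by [].
  nra.
- by exists L => //; exists (- ln c).
Qed.

Lemma rate_lt0 w L C : allowed_word A w ->
  (forall n, 0 < mass P w p n) ->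
  (forall n, n%:R * L <= ln (mass P w p n) + C) -> L < 0.
Proof.
move=> Aw m0 LC; have [K [c [c0 c1 cK]]] := surv_decay Airr AP Aw.
have mK j : mass P w p (j * K)%N <= c ^+ j.
  elim: j => [|j IHj]; first by apply: mass_le1; have [_ []] := pP.
  rewrite mulSn addnC exprSr; apply: le_trans (mass_cat P_ge0 p_ge0 _ cK) _.
  by apply: ler_wpM2r => //; apply: ltW.
have : K%:R * L - ln c <= 0.
  apply: (@natmul_bounded_le0 _ _ C) => j.
  have := LC (j * K)%N; have : ln (mass P w p (j * K)%N) <= ln (c ^+ j).
    by rewrite ler_ln ?posrE ?exprn_gt0.
  by rewrite lnXn // -[ln c *+ j]mulr_natl natrM mulrBr -mulrA; lra.
have lnc : ln c < 0 by rewrite ln_lt0 // c0.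
move=> KL; rewrite ltNge; apply/negP => L0.
have : 0 <= K%:R * L by rewrite mulr_ge0.
lra.
Qed.

(** Over [K] steps [mass] loses at least the proportion [1 - c], but by [mass_step] at most [K]
    times a multiple of [surv]. *)
Lemma mass_le_surv u a b : (1 < size u)%N ->
  (forall i, head i u = a) -> (forall i, last i u = b) ->
  prime_word u -> allowed_word A u ->
  exists2 C, 0 < C & forall n, mass P u p (n + (size u).-2)%N <= C * surv P u b n.
Proof.
move=> u1 ua ub uP Au; have [K [c [c0 c1 cK]]] := surv_decay Airr AP Au.
have [_ [p1 pS]] := pP.
pose D := delta P u * p 0 a.
have D0 : 0 <= D.
  by rewrite mulr_ge0 // /delta; apply: prodr_ge0.
have step k n : mass P u p (n + (size u).-2)%N - mass P u p (n + (size u).-2 + k)%N <=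
    k%:R * (D * surv P u b n).
  elim: k => [|k IHk]; first by rewrite addn0 subrr mul0r.
  have un : ((size u).-1 <= (n + (size u).-2 + k).+1)%N by lia.
  have := mass_step P_sum1 u1 ua ub p1 pS uP un.
  rewrite -/D (_ : (n + (size u).-2 + k).+1 - (size u).-1 = n + k)%N; last by lia.
  have : D * surv P u b (n + k)%N <= D * surv P u b n.
    by apply: ler_wpM2l => //; apply: surv_nincr => //; apply: leq_addr.
  by rewrite addnS -natr1 mulrDl mul1r; lra.
have c1' : 0 < 1 - c by rewrite subr_gt0.
(* The [+ 1] only serves to make the constant positive. *)
exists ((K%:R * D + 1) / (1 - c)); first by rewrite divr_gt0 // ltr_wpDl // mulr_ge0.
move=> n; rewrite mulrAC ler_pdivlMr //.
have := step K n; have := mass_cat P_ge0 p_ge0 (n + (size u).-2) cK.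
have := surv_ge0 u P_ge0 b n.
by rewrite mulrDl mul1r mulrA mulrBr mulr1; lra.
Qed.

End EscapeRates.

(** * Comparison of the two escape rates *)

Lemma same_ends (T : eqType) (u w : seq T) : (1 < size u)%N -> size w = size u ->
  take 1 w = take 1 u -> drop (size u).-1 w = drop (size u).-1 u ->
  exists a b, [/\ forall i, head i u = a, forall i, last i u = b,
                  forall i, head i w = a & forall i, last i w = b].
Proof.
case: u => [//|a u]; case: w => [//|c w] _ swu; rewrite /= !take0 => -[->].
case/lastP: u swu => [|u b]; case/lastP: w => [|w d] //=; rewrite ?size_rcons //.
- by move=> _ _; exists a, a.
- move=> [swu]; rewrite -swu /= -!cats1 !drop_size_cat // => -[->].
  by exists a, b; split=> // i; rewrite last_cat.
Qed.

Theorem theorem5p1 (R : realType) (N : nat) (A : 'I_N -> 'I_N -> bool)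
    (P : 'M[R]_N) (p : 'rV[R]_N) (u w : seq 'I_N) :
  irreducible_mx A ->
  compatible_stochastic A P ->
  stationary_vector P p ->
  allowed_word A u -> prime_word u -> (2 <= size u)%N ->
  allowed_word A w -> size w = size u ->
  take 1 w = take 1 u -> drop (size u).-1 w = drop (size u).-1 u ->
  delta P w = delta P u ->
  rho P p w <= rho P p u /\
  ((forall l : R, 0 < l -> eigenvalue P l -> l = 1) ->
     (rho P p w = rho P p u <-> prime_word w)).
Proof.
move=> Airr AP pS Au uP u1 Aw swu tk dr dwu.
(* Equal words are set aside because the trajectory avoiding [u] runs along [w]. *)
have [<-|/eqP uw] := eqVneq u w; first by split.
have [a [b [ua ub wa wb]]] := same_ends u1 swu tk dr.
(* Equal end letters would be an overlap of length one in [u]. *)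
have ab : a <> b.
  move=> ab; have ltu : (0 < (size u).-1 < size u)%N by lia.
  apply: (uP _ ltu).
  rewrite (_ : size u - (size u).-1 = 1)%N; last by lia.
  case: (u) u1 (ua a) (ub b) => [//|c s] _ /= -> sb.
  by rewrite take0 lastI sb -cats1 -(size_belast a s) drop_size_cat // ab.
have [P0 [P1 PA]] := AP; have p0 := stationary_gt0 Airr AP pS.
have u0 : (0 < size u)%N by exact: ltnW.
have w0 : (0 < size w)%N by rewrite swu.
have w1 : (1 < size w)%N by rewrite swu.
have pge i : 0 <= p 0 i by exact: ltW.
have [e e0 eP] := transition_lbound AP.
have [y Ay yu] := avoiding_trajectory Airr uP u0 ua wa swu Aw uw.
have ulb n : p 0 (y 0%N) * e ^+ n <= mass P u p n.
  apply: le_trans (surv_le_mass _ P0 pge (y 0%N) n); rewrite ler_pM2l //.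
  have := @pexp_path_ge _ _ _ P0 A y e n (fun t => (~~ infix u t)%:R) (ltW e0) eP Ay.
  by rewrite yu mulr1; apply.
have [Lu rLu [Cu LuC]] := mass_rate Airr AP pS (p0 _) e0 ulb.
have [C C0 uC] := mass_le_surv Airr AP pS u1 ua ub uP Au.
have swlb n : surv P u b n <= surv P w b n by exact: surv_le.
(* The chain of bounds goes from [mass] of [u] to [surv] of [u], then to [surv] of [w], and back to
   [mass] of [w]. *)
have wlb n : mass P u p (n + (size u).-2)%N <= C / p 0 b * mass P w p n.
  apply: le_trans (uC n) _; rewrite -mulrA ler_pM2l // ler_pdivlMl //.
  apply: le_trans (surv_le_mass _ P0 pge b n); by rewrite ler_pM2l.
have Cb0 : 0 < C / p 0 b by rewrite divr_gt0.
pose d := p 0 (y 0%N) * e ^+ (size u).-2 / (C / p 0 b).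
have d0 : 0 < d by rewrite divr_gt0 // mulr_gt0 ?exprn_gt0.
have dlb n : d * e ^+ n <= mass P w p n.
  rewrite -(ler_pM2l Cb0); apply: le_trans (wlb n); apply: le_trans (ulb _).
  by rewrite mulrA [_ * d]mulrC divfK ?gt_eqF // -mulrA -exprD addnC.
have [Lw rLw [Cw LwC]] := mass_rate Airr AP pS d0 e0 dlb.
have um n : 0 < mass P u p n.
  by apply: lt_le_trans (ulb n); rewrite mulr_gt0 ?exprn_gt0.
have wm n : 0 < mass P w p n.
  by apply: lt_le_trans (dlb n); rewrite mulr_gt0 ?exprn_gt0.
rewrite (rho_rate u0 rLu) (rho_rate w0 rLw) lerN2; split.
  apply: (rate_le (rate_shift (size u).-2 rLu) rLw (B := ln (C / p 0 b))) => n.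
  by rewrite addrC -lnM ?posrE // ler_ln ?posrE // mulr_gt0.
move=> _; split=> [/oppr_inj LE|wP]; last first.
  rewrite -(rho_rate u0 rLu) -(rho_rate w0 rLw) /rho.
  have mE := mass_eq P1 u1 swu ua ub wa wb dwu uP pS wP.
  by under eq_fun do rewrite mu_WE // mE swu -mu_WE //.
apply: contrapT => wnP.
have [s s0 phi0] := overlaps_nonprime P0 w1 wa wb ab e0 eP Aw wnP.
have L0 : Lu < 0 by exact: rate_lt0 Au um LuC.
have V1 : surv P w b 0%N = 1 by exact: surv_short.
(* The constant is read off from [LuC] at [n + (size u).-2] combined with [uC]. *)
pose c := expR (Lu *+ (size u).-2) / (C * expR Cu).
have c0 : 0 < c by rewrite divr_gt0 ?mulr_gt0 ?expR_gt0.
apply: (@renewal_strict R (surv P u b) (surv P w b) (first_hit P w b) Lu c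
          (overlaps P w b s) s) => //.
- move=> n; rewrite mulrAC ler_pdivrMr ?mulr_gt0 ?expR_gt0 //.
  rewrite mulrA [surv _ _ _ _ * C]mulrC.
  apply: (@le_trans _ _ (mass P u p (n + (size u).-2)%N * expR Cu)); last first.
    by rewrite ler_pM2r ?expR_gt0.
  rewrite -expRM_natl -expRD -[mass _ _ _ _]lnK ?posrE // -expRD ler_expR.
  apply: le_trans (LuC _); rewrite natrD mulrDl -[Lu *+ _]mulr_natl; lra.
- by move=> n; apply: surv_ge0.
- by rewrite /first_hit fpsBE fps_sub1X0 V1 subrr.
- by move=> n; rewrite /first_hit fpsBE fps_sub1XS fps1E sub0r opprB.
- by move=> n; apply: first_hit_ge0.
- move=> n.
  have := surv_gain P0 P1 u1 swu ua ub wa wb dwu uP s0 (leq_addl n s).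
  rewrite addnK; apply: le_trans; rewrite lerDr; exact: surv_ge0.
(* The upper bound on the survival of [w] comes from its own rate, equal to [Lu] by [LE]. *)
move=> eps eps0; have [M wM] := rLw _ eps0; exists (M - ln (p 0 b)) => n.
have -> : surv P w b n = p 0 b * surv P w b n / p 0 b by rewrite mulrAC divff ?mul1r ?gt_eqF.
rewrite ler_pdivrMr //; apply: le_trans (surv_le_mass _ P0 pge b n) _.
rewrite -[X in _ <= _ * X]lnK ?posrE // -expRD -[leLHS]lnK ?posrE // ler_expR.
by have := wM n; rewrite ler_norml LE; lra.
Qed.
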